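(* For $n\in\mathbb{N}$ let $$\mathcal{A}_n=\begin{pmatrix}A_n&0\\C_n&D_n\end{pmatrix}$$ be a lower triangular operator matrix in $\mathcal{H}_n=\mathcal{H}_{1,n}\oplus\mathcal{H}_{2,n}$ such that $A_n$, $D_n$ are densely defined, $C_n$, $D_n$ are closable, $\operatorname{dom}(A_n)\subset\operatorname{dom}(C_n)$ and $\rho(A_n)\neq\emptyset$. Assume that $(C_n)_{n\in\mathbb{N}}$ is uniformly $(A_n)_{n\in\mathbb{N}}$-bounded, i.e. there exist $a,b>0$ and $N\in\mathbb{N}$ such that $$\|C_nx\|^2\le a\|x\|^2+b\|A_nx\|^2,\qquad x\in\operatorname{dom}(A_n),\ n\ge N.$$ Then $$\sigma_{e2}((D_n)_{n\in\mathbb{N}})\subset\sigma_{e2}((\overline{\mathcal{A}_n})_{n\in\mathbb{N}})\subset\sigma_{e2}((A_n)_{n\in\mathbb{N}})\cup\sigma_{e2}((D_n)_{n\in\mathbb{N}}).$$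
   Context: $\mathcal{H}_0=\mathcal{H}_{1,0}\oplus\mathcal{H}_{2,0}$ is a Hilbert space; for $i=1,2$ and $n\in\mathbb{N}$, $\mathcal{H}_i,\mathcal{H}_{i,n}\subset\mathcal{H}_{i,0}$ are closed subspaces with orthogonal projections $P_i:\mathcal{H}_{i,0}\to\mathcal{H}_i$, $P_{i,n}:\mathcal{H}_{i,0}\to\mathcal{H}_{i,n}$, and $P_{i,n}\to P_i$ strongly in $\mathcal{H}_{i,0}$. $A_n$ acts in $\mathcal{H}_{1,n}$, $D_n$ in $\mathcal{H}_{2,n}$, $C_n$ from $\mathcal{H}_{1,n}$ to $\mathcal{H}_{2,n}$, $\operatorname{dom}(\mathcal{A}_n)=\operatorname{dom}(A_n)\oplus\operatorname{dom}(D_n)$. Under the assumptions $\mathcal{A}_n$ is closable with closure $\overline{\mathcal{A}_n}=\begin{pmatrix}A_n&0\\C_n&\overline{D_n}\end{pmatrix}$ on $\operatorname{dom}(A_n)\oplus\operatorname{dom}(\overline{D_n})$. Limiting essential spectrum of a sequence of operators $B_n$ in closed subspaces of a fixed Hilbert space $\mathcal{K}_0$: $\sigma_{e2}((B_n)_{n\in\mathbb{N}})$ is the set of $\lambda\in\mathbb{C}$ for which there are an infinite $I\subset\mathbb{N}$ and $x_n\in\operatorname{dom}(B_n)$, $\|x_n\|=1$, $n\in I$, with $x_n\rightharpoonup0$ in $\mathcal{K}_0$ and $\|(B_n-\lambda)x_n\|\to0$. *)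

(* Defs.v *)
From HB Require Import structures.
From mathcomp Require Import all_boot all_order all_algebra complex.
From mathcomp Require Import all_classical all_reals.
From mathcomp Require Import topology normedtype sequences.
From mathcomp Require Import sesquilinear ring.

Set Implicit Arguments.
Unset Strict Implicit.
Unset Printing Implicit Defensive.

Import Order.TTheory GRing.Theory Num.Theory.
Import numFieldNormedType.Exports.

Local Open Scope classical_set_scope.
Local Open Scope ring_scope.
Local Open Scope complex_scope.

(** The inner product is linear in its first argument. *)

HB.mixin Record CompleteNormedModule_isHilbert (R : realType) V
    of CompleteNormedModule R[i] V := {
  inner : {dot V for Num.conj};
  sqr_normE : forall x : V, `|x| ^+ 2 = inner x x
}.

#[short(type="hilbertType")]
HB.structure Definition Hilbert (R : realType) :=
  {V of CompleteNormedModule R[i] V & CompleteNormedModule_isHilbert R V}.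

Lemma sqrtC_minkowski (C : numClosedFieldType) (a b c d : C) :
  0 <= a -> 0 <= b -> 0 <= c -> 0 <= d ->
  sqrtC ((a + c) ^+ 2 + (b + d) ^+ 2) <=
  sqrtC (a ^+ 2 + b ^+ 2) + sqrtC (c ^+ 2 + d ^+ 2).
Proof.
move=> a0 b0 c0 d0.
have sq0 (u v : C) : 0 <= u -> 0 <= v -> 0 <= u ^+ 2 + v ^+ 2.
  by move=> u0 v0; rewrite addr_ge0// exprn_ge0.
have [ac0 bd0] : 0 <= a + c /\ 0 <= b + d by rewrite !addr_ge0.
set p := sqrtC (a ^+ 2 + _); set q := sqrtC (c ^+ 2 + _).
have p0 : 0 <= p by rewrite sqrtC_ge0 sq0.
have q0 : 0 <= q by rewrite sqrtC_ge0 sq0.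
have pE : p ^+ 2 = a ^+ 2 + b ^+ 2 by rewrite sqrtCK.
have qE : q ^+ 2 = c ^+ 2 + d ^+ 2 by rewrite sqrtCK.
rewrite -ler_sqr ?nnegrE ?sqrtC_ge0 ?addr_ge0// ?exprn_ge0// sqrtCK.
have le_pq : a * c + b * d <= p * q.
  rewrite -ler_sqr ?nnegrE ?addr_ge0 ?mulr_ge0// exprMn pE qE -subr_ge0.
  have -> : (a ^+ 2 + b ^+ 2) * (c ^+ 2 + d ^+ 2) - (a * c + b * d) ^+ 2
            = (a * d - b * c) ^+ 2 by ring.
  by rewrite real_exprn_even_ge0// rpredB// rpredM// ger0_real.
have -> : (a + c) ^+ 2 + (b + d) ^+ 2 = p ^+ 2 + (a * c + b * d) *+ 2 + q ^+ 2.
  by rewrite pE qE; ring.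
by rewrite sqrrD lerD2r lerD2l lerMn2r le_pq orbT.
Qed.

(** The orthogonal direct sum. It is an alias of the product, because the
    library's norm on a product is the maximum norm. *)

Definition hsum (V W : Type) : Type := (V * W)%type.

Section HilbertSum.
Variables (R : realType) (V W : hilbertType R).
Local Notation C := R[i].

HB.instance Definition _ := GRing.Lmodule.copy (hsum V W) (V * W)%type.

Definition hsum_norm (x : hsum V W) : C := sqrtC (`|x.1| ^+ 2 + `|x.2| ^+ 2).

Let hsum_norm_ge0 x : 0 <= hsum_norm x.
Proof. by rewrite sqrtC_ge0 addr_ge0// exprn_ge0. Qed.

Let hsum_normD x y : hsum_norm (x + y) <= hsum_norm x + hsum_norm y.
Proof.
apply: le_trans (sqrtC_minkowski _ _ _ _); rewrite ?normr_ge0//.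
rewrite ler_sqrtC ?nnegrE ?addr_ge0 ?exprn_ge0 ?addr_ge0//.
by apply: lerD; rewrite lerXn2r ?nnegrE ?addr_ge0// ler_normD.
Qed.

Let hsum_normZ (l : C) x : hsum_norm (l *: x) = `|l| * hsum_norm x.
Proof.
rewrite /hsum_norm /= !normrZ !exprMn -mulrDr rootCMl ?exprn_ge0//.
by rewrite sqrCK.
Qed.

Let hsum_norm_eq0 x : hsum_norm x = 0 -> x = 0.
Proof.
move/eqP; rewrite sqrtC_eq0 paddr_eq0 ?exprn_ge0// !sqrf_eq0 !normr_eq0.
by case: x => x1 x2 /= /andP[/eqP -> /eqP ->].
Qed.

HB.instance Definition _ :=
  Lmodule_isNormed.Build C (hsum V W) hsum_normD hsum_normZ hsum_norm_eq0.

Lemma hsum_normE (x : hsum V W) : `|x| = sqrtC (`|x.1| ^+ 2 + `|x.2| ^+ 2).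
Proof. by []. Qed.

Lemma hsum_norm_fst (x : hsum V W) : `|x.1| <= `|x|.
Proof.
rewrite hsum_normE -[leLHS]sqrCK// ler_sqrtC ?nnegrE ?addr_ge0 ?exprn_ge0//.
by rewrite lerDl exprn_ge0.
Qed.

Lemma hsum_norm_snd (x : hsum V W) : `|x.2| <= `|x|.
Proof.
rewrite hsum_normE -[leLHS]sqrCK// ler_sqrtC ?nnegrE ?addr_ge0 ?exprn_ge0//.
by rewrite lerDr exprn_ge0.
Qed.

Lemma hsum_norm_le (x : hsum V W) : `|x| <= `|x.1| + `|x.2|.
Proof.
rewrite hsum_normE -[leRHS]sqrCK ?addr_ge0//.
rewrite ler_sqrtC ?nnegrE ?exprn_ge0 ?addr_ge0 ?exprn_ge0// sqrrD lerD2r.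
by rewrite lerDl mulrn_wge0// mulr_ge0.
Qed.

Let hsum_complete (F : set_system (hsum V W)) :
  ProperFilter F -> cauchy F -> cvg F.
Proof.
move=> FF /cauchyP F_cauchy.
have /cauchy_cvg/cvg_ex[/= l1 Fl1] : cauchy ((fun x : hsum V W => x.1) @ F).
  apply: cauchy_exP => e /F_cauchy[x Fx]; exists x.1; near_simpl.
  apply: (@filterS _ F _ (ball x e)) => // y; rewrite -!ball_normE /=; apply: le_lt_trans.
  exact: (hsum_norm_fst (x - y)).
have /cauchy_cvg/cvg_ex[/= l2 Fl2] : cauchy ((fun x : hsum V W => x.2) @ F).
  apply: cauchy_exP => e /F_cauchy[x Fx]; exists x.2; near_simpl.
  apply: (@filterS _ F _ (ball x e)) => // y; rewrite -!ball_normE /=; apply: le_lt_trans.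
  exact: (hsum_norm_snd (x - y)).
apply/cvg_ex; exists ((l1, l2) : hsum V W); apply/cvgrPdist_lt => e e0.
have e20 : 0 < e / 2 by rewrite divr_gt0.
move/cvgrPdist_lt/(_ _ e20) : Fl1 => F1; move/cvgrPdist_lt/(_ _ e20) : Fl2 => F2.
near=> x; apply: le_lt_trans (hsum_norm_le _) _; rewrite [e]splitr ltrD//=.
- by near: x.
- by near: x.
Unshelve. all: by end_near. Qed.

HB.instance Definition _ :=
  Uniform_isComplete.Build (hsum V W) hsum_complete.

Definition hsum_inner (x y : hsum V W) : C := inner x.1 y.1 + inner x.2 y.2.

Let hsum_inner_bilinear :
  bilinear_for (GRing.Scale.Law.clone _ _ *%R _)
    (GRing.Scale.Law.clone _ _ (Num.conj \; *%R) _) hsum_inner.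
Proof.
split=> z a x y; rewrite /hsum_inner /=.
  by rewrite !linearPl /=; ring.
by rewrite !linearPr /=; ring.
Qed.

HB.instance Definition _ := bilinear_isBilinear.Build C (hsum V W) (hsum V W) C
  _ _ hsum_inner hsum_inner_bilinear.

Let hsum_inner_hermitian x y :
  hsum_inner x y = (-1) ^+ false * Num.conj (hsum_inner y x).
Proof.
rewrite expr0 mul1r /hsum_inner rmorphD /= [inner x.1 _]hermC [inner x.2 _]hermC.
by rewrite expr0 !mul1r.
Qed.

HB.instance Definition _ :=
  isHermitianSesquilinear.Build C (hsum V W) false Num.conj hsum_inner
    hsum_inner_hermitian.

Let sqr_hsum_norm (x : hsum V W) : `|x| ^+ 2 = hsum_inner x x.
Proof. by rewrite hsum_normE sqrtCK /hsum_inner -!sqr_normE. Qed.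

Let hsum_inner_gt0 x : x != 0 -> 0 < hsum_inner x x.
Proof. by move=> x0; rewrite -sqr_hsum_norm exprn_gt0// normr_gt0. Qed.

HB.instance Definition _ :=
  isDotProduct.Build C (hsum V W) hsum_inner hsum_inner_gt0.

HB.instance Definition _ :=
  CompleteNormedModule_isHilbert.Build R (hsum V W) sqr_hsum_norm.

Lemma hsum_innerE (x y : hsum V W) :
  inner x y = inner x.1 y.1 + inner x.2 y.2.
Proof. by []. Qed.

End HilbertSum.

Section Subspaces.
Variables (R : realType) (H : hilbertType R).

Definition subspace (E : set H) : Prop :=
  E 0 /\ forall (a : R[i]) x y, E x -> E y -> E (a *: x + y).

Definition closed_subspace (E : set H) : Prop := subspace E /\ closed E.

Definition orthogonal_projection (E : set H) (P : H -> H) : Prop :=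
  forall x, E (P x) /\ forall y, E y -> inner (x - P x) y = 0.

Definition weakly_cvg (F : set_system nat) (x : nat -> H) (l : H) : Prop :=
  forall y, (inner (x n) y : R[i]^o) @[n --> F] --> (inner l y : R[i]^o).

End Subspaces.

Section Operators.
Variables (R : realType) (H K : hilbertType R).

(** The values of an operator outside its domain are irrelevant. *)
Record operator := Operator { dom : set H; op_fun :> H -> K }.

Definition graph (T : operator) : set (H * K) :=
  [set p | dom T p.1 /\ p.2 = T p.1].

Definition linear_operator (T : operator) : Prop :=
  subspace (dom T) /\
  forall (a : R[i]) x y, dom T x -> dom T y -> T (a *: x + y) = a *: T x + T y.

Definition operator_from_to (E : set H) (F : set K) (T : operator) : Prop :=
  [/\ linear_operator T, dom T `<=` E & forall x, dom T x -> F (T x)].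

Definition densely_defined_in (E : set H) (T : operator) : Prop :=
  E `<=` closure (dom T).

Definition closable (T : operator) : Prop :=
  exists S : operator, graph S = closure (graph T).

(** If [T] is closable, every section of [closure (graph T)] is empty or a
    singleton, so that [xget 0] picks the only possible value. *)
Definition op_closure (T : operator) : operator :=
  Operator
    [set x | exists y, closure (graph T) (x, y)]
    (fun x => xget 0 [set y | closure (graph T) (x, y)]).

Lemma graph_op_closure (T : operator) :
  closable T -> graph (op_closure T) = closure (graph T).
Proof.
move=> [S ST]; apply/seteqP; split => [[x y] [/= [z xz] ->]|[x y] xy].
  by apply: (@xgetPex _ 0 [set y | closure (graph T) (x, y)]); exists z.
have uniq z : closure (graph T) (x, z) -> z = S x by rewrite -ST => -[].
split=> /=; first by exists y.
rewrite (uniq y xy); apply/esym/uniq.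
by apply: (@xgetPex _ 0 [set y | closure (graph T) (x, y)]); exists y.
Qed.

End Operators.

(** [T] is regarded as an operator in the subspace [E]: the inverse of [T - l]
    is required to be defined on [E], not on [H]. *)
Definition resolvent_set (R : realType) (H : hilbertType R) (E : set H)
    (T : operator H H) : set R[i] :=
  [set l | set_bij (dom T) E (fun x => T x - l *: x) /\
    exists c : R, forall x, dom T x -> `|x| <= c%:C * `|T x - l *: x|].

(** The operator matrix with rows [(A, 0)] and [(C, D)]; it is used when
    [dom A `<=` dom C]. *)
Definition lower_triangular (R : realType) (H1 H2 : hilbertType R)
    (A : operator H1 H1) (C : operator H1 H2) (D : operator H2 H2) :
    operator (hsum H1 H2) (hsum H1 H2) :=
  Operator
    [set x : hsum H1 H2 | dom A x.1 /\ dom D x.2]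
    (fun x : hsum H1 H2 => ((A x.1, C x.1 + D x.2) : hsum H1 H2)).

Definition uniformly_bounded (R : realType) (H K : hilbertType R)
    (A : nat -> operator H H) (C : nat -> operator H K) : Prop :=
  exists (a b : R) (N : nat), [/\ 0 < a, 0 < b &
    forall n x, (N <= n)%N -> dom (A n) x ->
      `|C n x| ^+ 2 <= a%:C * `|x| ^+ 2 + b%:C * `|A n x| ^+ 2].

Definition sigma_e2 (R : realType) (H : hilbertType R)
    (B : nat -> operator H H) : set R[i] :=
  [set l | exists (I : set nat) (x : nat -> H),
    [/\ infinite_set I,
        forall n, I n -> dom (B n) (x n) /\ `|x n| = 1,
        weakly_cvg (within I \oo) x 0 &
        (`|B n (x n) - l *: x n| : R[i]^o) @[n --> within I \oo]
          --> (0 : R[i]^o)]].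

(* Main.v *)
Require Import Defs.
From mathcomp Require Import all_boot all_order all_algebra complex.
From mathcomp Require Import all_classical all_reals interval_inference.
From mathcomp Require Import topology normedtype sequences.
From mathcomp Require Import sesquilinear ring.

(** A singular sequence at [l] is a weakly null sequence of unit vectors of the
    domains along which [B_n - l] tends to [0], so the theorem is a matter of
    transporting singular sequences between the matrices and their diagonal
    entries.

    The closure of the matrix has to be known first. Since [A_n] has a
    resolvent point, it is closed ([resolvent_closed_operator]). For large [n],
    [C_n] is [A_n]-bounded, so convergence in the graph of [A_n] entails
    convergence of [C_n]; hence the closure of the matrix keeps [A_n] and
    [C_n] and only replaces [D_n] by its closure ([closure_lower_triangular]).

    Embedding [y_n] as [(0, y_n)] turns singular sequences of [D_n] into
    singular sequences of the matrices. Conversely, let [(x_n, y_n)] be singular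
    for the closed matrices. As the matrix is lower triangular, [x_n] satisfies
    the approximate eigenvalue equation of [A_n] by itself. Either [x_n] stays
    away from [0] along a subsequence, and then [l] belongs to the limiting
    essential spectrum of [A_n]; or [x_n --> 0], in which case [A_n x_n --> 0]
    and the uniform bound gives [C_n x_n --> 0], so that [y_n] is asymptotically
    singular for the closures of the [D_n]. Approximating it in the graph norm
    by vectors of the domains of [D_n], and dividing by the norms, which stay
    away from [0] ([sigma_e2_bounded_below]), puts [l] in the limiting
    essential spectrum of [D_n]. *)

Set Implicit Arguments.
Unset Strict Implicit.
Unset Printing Implicit Defensive.

Import Order.TTheory GRing.Theory Num.Theory.
Import numFieldNormedType.Exports.
Local Open Scope classical_set_scope.
Local Open Scope ring_scope.
Local Open Scope complex_scope.

(** * Limits along a filter and along an infinite set of indices *)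

Section Limits.
Variables (K : numFieldType) (T : Type) (F : set_system T).
Hypothesis FF : Filter F.

Lemma cvg0_norm_le (V : normedModType K) (f : T -> V) (k : T -> K) :
  (\forall t \near F, `|f t| <= k t) -> k @ F --> (0 : K^o) ->
  f @ F --> (0 : V).
Proof.
move=> fk /cvgr0Pnorm_lt k0; apply/cvgr0Pnorm_lt => e /k0.
apply: filterS2 fk => t fk; apply: le_lt_trans.
by rewrite ger0_norm// (le_trans _ fk).
Qed.

Lemma cvg0_sqr_norm_le (V : normedModType K) (f : T -> V) (k : T -> K) :
  (\forall t \near F, `|f t| ^+ 2 <= k t) -> k @ F --> (0 : K^o) ->
  f @ F --> (0 : V).
Proof.
move=> fk /cvgr0Pnorm_lt k0; apply/cvgr0Pnorm_lt => e e0.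
have /k0 : 0 < e ^+ 2 by rewrite exprn_gt0.
apply: filterS2 fk => t fk ke.
rewrite -ltr_sqr ?nnegrE ?(ltW e0)//; apply: le_lt_trans ke.
by rewrite ger0_norm// (le_trans _ fk) ?exprn_ge0.
Qed.

(** This is how relative boundedness enters: when [f], [g] and [h] are
    [C_n x_n], [x_n] and [A_n x_n], it turns convergence in the graph norm of
    [A_n] into convergence of [C_n x_n], uniformly in [n]. *)
Lemma cvg0_relatively_bounded (U V W : normedModType K) (f : T -> U)
    (g : T -> V) (h : T -> W) (a b : K) :
  (\forall t \near F, `|f t| ^+ 2 <= a * `|g t| ^+ 2 + b * `|h t| ^+ 2) ->
  g @ F --> (0 : V) -> h @ F --> (0 : W) -> f @ F --> (0 : U).
Proof.
move=> le_f /norm_cvg0P g0 /norm_cvg0P h0.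
apply: (cvg0_sqr_norm_le le_f).
have lim0 (c : K) (u : T -> K) : u @ F --> (0 : K^o) ->
    (fun t => c * u t ^+ 2) @ F --> (0 : K^o).
  move=> u0; rewrite -[X in _ --> X](mulr0 c).
  apply: cvgM; first exact: cvg_cst.
  by rewrite -[X in _ --> X](mulr0 (0 : K)); apply: cvgM.
rewrite -[X in _ --> X](addr0 (0 : K^o)).
by apply: (@cvgD _ K^o); apply: lim0.
Qed.

End Limits.

(** A positive complex number is real, so convergence reduces to that of the
    real harmonic sequence. *)
Lemma cvg_harmonicC (R : realType) :
  (n.+1%:R^-1 : R[i]) @[n --> \oo] --> (0 : R[i]^o).
Proof.
apply: (proj2 (@cvgr0Pnorm_lt _ R[i]^o _ _ _ _)) => e e0.
have eE : e = (complex.Re e)%:C by rewrite RRe_real// gtr0_real.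
have re0 : 0 < complex.Re e by rewrite eE ltcR in e0.
near=> n; rewrite ger0_norm ?invr_ge0//.
have lt_re : n.+1%:R^-1 < complex.Re e.
  by near: n; exact: (near_infty_natSinv_lt (PosNum re0)).
by rewrite eE -(rmorph_nat (real_complex R)) -fmorphV ltcR.
Unshelve. all: by end_near. Qed.

(** Membership of the index set is only ever used eventually or frequently, so
    infinite sets of indices are handled as the ones that are met frequently. *)
Lemma infinite_set_natP (I : set nat) :
  infinite_set I <-> ~ \forall n \near \oo, ~ I n.
Proof.
split=> [Iinf [N _ NI]|nI /finite_seqP[s Is]].
  apply: Iinf; apply: (@sub_finite_set _ _ `I_N); last exact: finite_II.
  move=> n In /=; rewrite ltnNge; apply/negP => Nn.
  exact: (NI n Nn In).
apply: nI; exists (\max_(i <- s) i).+1 => // n /= ltn In.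
have ns : n \in s by move: In; rewrite Is.
by move: ltn; rewrite ltnNge (leq_bigmax_seq (F := id)).
Qed.

(** Passing to a subsequence: finitely many indices of [I] may be dropped. *)
Lemma infinite_set_near (I P : set nat) :
  infinite_set I -> (\forall n \near within I \oo, P n) ->
  infinite_set (I `&` P).
Proof.
move=> /infinite_set_natP nI IP; apply/infinite_set_natP => nIP; apply: nI.
near=> n => In; have: (I `&` P) n.
  by split=> //; move: In; near: n; exact: IP.
by near: n.
Unshelve. all: by end_near. Qed.

Lemma cvg_withinS (T : Type) (F : set_system T) (FF : Filter F)
    (I J : set T) :
  J `<=` I -> within J F --> within I F.
Proof. by move=> JI P IP; apply: (@filterS _ F _ _ _ _ IP) => t Pt /JI. Qed.

(** * Cauchy-Schwarz and weakly null sequences *)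

Section Hilbert.
Variables (R : realType) (H : hilbertType R).

(** The square norm of [inner v v *: u - inner u v *: v], a multiple of the
    component of [u] orthogonal to [v], is [inner v v] times the defect in the
    inequality; it is nonnegative. *)
Lemma norm_inner_le (u v : H) : `|inner u v| <= `|u| * `|v|.
Proof.
have [->|v0] := eqVneq v 0; first by rewrite linear0r !normr0 mulr0.
have nv0 : 0 < inner v v by rewrite -sqr_normE exprn_gt0// normr_gt0.
set w := inner v v *: u - inner u v *: v.
have wE : inner w w
  = inner v v * (inner u u * inner v v - `|inner u v| ^+ 2).
  have cvv : Num.conj (inner v v) = inner v v by rewrite geC0_conj// ltW.
  have vuE : inner v u = Num.conj (inner u v) by rewrite hermC expr0 mul1r.
  rewrite /w !linearBr !linearBl /= !linearZr_LR !linearZl_LR /= cvv vuE normCK.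
  by ring.
have : 0 <= inner w w by rewrite -sqr_normE exprn_ge0.
rewrite wE pmulr_rge0// subr_ge0 -!sqr_normE -exprMn.
by rewrite ler_sqr ?nnegrE ?mulr_ge0.
Qed.

Lemma weakly_cvg_subset (F G : set_system nat) (x : nat -> H) l :
  G --> F -> weakly_cvg F x l -> weakly_cvg G x l.
Proof. by move=> GF xl y; apply: cvg_trans (xl y); apply: cvg_app. Qed.

Lemma weakly_cvg0_dist (F : set_system nat) (FF : Filter F) (x y : nat -> H) :
  weakly_cvg F x 0 -> y n - x n @[n --> F] --> (0 : H) -> weakly_cvg F y 0.
Proof.
move=> x0 /norm_cvg0P xy0 w; rewrite linear0l.
have -> : (fun n => inner (y n) w) =
    (fun n => inner (y n - x n) w + inner (x n) w).
  by apply/funext => n; rewrite linearBl subrK.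
rewrite -[X in _ --> X](addr0 (0 : R[i]^o)).
apply: (@cvgD _ R[i]^o); last first.
  by have := x0 w; rewrite linear0l.
apply: (@cvg0_norm_le _ _ _ _ R[i]^o _ (fun n => `|y n - x n| * `|w|)).
  by apply: nearW => n; apply: norm_inner_le.
by rewrite -[X in _ --> X](mul0r `|w|); apply: (cvgM xy0); exact: cvg_cst.
Qed.

Lemma weakly_cvg0_scale (F : set_system nat) (FF : Filter F) (x : nat -> H)
    (k : nat -> R[i]) (c : R[i]) :
  weakly_cvg F x 0 -> (\forall n \near F, `|k n| <= c) ->
  weakly_cvg F (fun n => k n *: x n) 0.
Proof.
move=> x0 kc w; rewrite linear0l.
have := x0 w; rewrite linear0l => /(proj2 (@norm_cvg0P _ R[i]^o _ F _ _)) xw0.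
apply: (@cvg0_norm_le _ _ _ _ R[i]^o _ (fun n => c * `|inner (x n) w|)).
  by apply: filterS kc => n kc; rewrite linearZl_LR normrM ler_wpM2r.
by rewrite -[X in _ --> X](mulr0 c); apply: (cvgM _ xw0); exact: cvg_cst.
Qed.

End Hilbert.
(** * Graphs, closures and closed operators *)

Section Graphs.
Variables (R : realType) (H K : hilbertType R).
Implicit Types T : operator H K.

Lemma linear_operatorB T x y : linear_operator T -> dom T x -> dom T y ->
  dom T (x - y) /\ T (x - y) = T x - T y.
Proof.
move=> [[_ domP] TP] Tx Ty.
have -> : x - y = (-1) *: y + x by rewrite scaleN1r addrC.
by split; [exact: domP|rewrite TP// scaleN1r addrC].
Qed.

Lemma linear_operator0 T : linear_operator T -> dom T 0 /\ T 0 = 0.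
Proof.
move=> Tl; have T0 : dom T 0 by have [[]] := Tl.
by have [] := linear_operatorB Tl T0 T0; rewrite !subrr.
Qed.

Lemma linear_operatorZ T a x : linear_operator T -> dom T x ->
  dom T (a *: x) /\ T (a *: x) = a *: T x.
Proof.
move=> Tl Tx; have [T0 T0E] := linear_operator0 Tl.
have [[_ domP] TP] := Tl.
split; first by rewrite -[a *: x]addr0; exact: domP.
by rewrite -[a *: x in LHS]addr0 TP// T0E addr0.
Qed.

(** A filter on the domain plays the role of an approximating sequence
    [u_k] with [u_k --> x] and [T u_k --> y]. *)
Lemma closure_graphP T x y : closure (graph T) (x, y) <->
  exists F : set_system H, ProperFilter F /\
    [/\ \forall u \near F, dom T u, F --> x & T @ F --> y].
Proof.
split=> [|[F [FF [FT Fx FTy]]]]; rewrite closureEcvg.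
  move=> [G GF [Gxy GT]]; exists (fst @ G).
  split; first exact: fmap_proper_filter.
  have Gg : \forall p \near G, graph T p by apply: GT.
  split.
  - by near_simpl; apply: (@filterS _ G _ _ _ _ Gg) => p [].
  - exact: (cvg_comp _ _ Gxy cvg_fst).
  - apply: (@cvg_trans _ (snd @ G)); last exact: (cvg_comp _ _ Gxy cvg_snd).
    apply: (@near_eq_cvg _ _ G _ snd (fun p => T p.1)).
    by apply: (@filterS _ G _ _ _ _ Gg) => p [_ ->].
exists ((fun u => (u, T u)) @ F); first exact: fmap_proper_filter.
split; first exact: (cvg_pair Fx FTy).
move=> P TP; rewrite /= /fmap /=; apply: (@filterS _ F _ _ _ _ FT) => u Tu.
by apply: TP; split.
Qed.

Lemma closure_graph_approx T x y (e : R[i]) : closure (graph T) (x, y) ->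
  0 < e -> exists u, [/\ dom T u, `|x - u| < e & `|y - T u| < e].
Proof.
move=> /closure_graphP[F [FF [FT /cvgrPdist_lt Fx /cvgrPdist_lt Fy]]] e0.
have [u [Tu [xu yu]]] : exists u, dom T u /\ `|x - u| < e /\ `|y - T u| < e.
  apply: (@filter_ex _ F).
  by near=> u; split; [|split]; near: u; [|exact: Fx|exact: Fy].
by exists u.
Unshelve. all: by end_near. Qed.

Lemma op_closure_graph T x : dom (op_closure T) x ->
  closure (graph T) (x, op_closure T x).
Proof.
move=> [y xy].
by apply: (@xgetPex _ 0 [set z | closure (graph T) (x, z)]); exists y.
Qed.

Lemma op_closure_eq T x y : closure (graph T) (x, y) ->
  (forall z, closure (graph T) (x, z) -> z = y) -> op_closure T x = y.
Proof. by move=> xy; apply; apply: op_closure_graph; exists y. Qed.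

Lemma closable_uniq T x y z : closable T ->
  closure (graph T) (x, y) -> closure (graph T) (x, z) -> y = z.
Proof. by move=> [S <-] [_ /= ->] [_ /= ->]. Qed.

End Graphs.

Definition closed_operator (R : realType) (H K : hilbertType R)
    (T : operator H K) : Prop := closed (graph T).

(** If [u --> x] and [T u --> y], the limits stay in the closed subspace [E], so
    [y - l *: x] has a preimage [w] under [T - l]. As [T - l] is bounded below,
    [(T - l) u --> (T - l) w] forces [u --> w], whence [x = w]. *)
Lemma resolvent_closed_operator (R : realType) (H : hilbertType R) (E : set H)
    (T : operator H H) :
  closed_subspace E -> operator_from_to E E T -> resolvent_set E T !=set0 ->
  closed_operator T.
Proof.
move=> [[_ E_lin] E_closed] [Tl domE imE] [l [[_ _ surjT] [c lec]]] [x y].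
move=> /closure_graphP[F [FF [FT Fx FTy]]].
have Ex : E x.
  by apply: (closed_cvg _ E_closed) Fx; apply: (@filterS _ F _ _ _ _ FT).
have Ey : E y.
  apply: (closed_cvg _ E_closed) FTy.
  by apply: (@filterS _ F _ _ _ _ FT) => u; exact: imE.
have [w Tw wE] : exists2 w, dom T w & T w - l *: w = y - l *: x.
  have [] := surjT (y - l *: x); last by move=> w; exists w.
  by rewrite addrC -scaleNr; exact: E_lin.
suff xw : x = w.
  by rewrite -xw in Tw wE; split=> //=; apply: (addIr (- (l *: x))).
have Fw : F --> w.
  apply/subr_cvg0/(@cvg0_norm_le _ _ _ _ _ _
    (fun u => c%:C * `|(T u - l *: u) - (y - l *: x)|)).
    apply: (@filterS _ F _ _ _ _ FT) => u Tu.
    have [Tuw TuwE] := linear_operatorB Tl Tu Tw.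
    apply: le_trans (lec _ Tuw) _.
    by rewrite -wE TuwE scalerBr opprD addrACA -opprD.
  rewrite -[X in _ --> X](mulr0 c%:C); apply: cvgM; first exact: cvg_cst.
  apply/norm_cvg0P/subr_cvg0; apply: cvgB => //; exact: cvgZl_tmp.
exact: (cvg_unique (@norm_hausdorff _ H) Fx Fw).
Qed.

(** Along approximants [u] of a point [(z, w)] of the closure, [(u.1, A u.1)]
    converges to a point of the closed graph of [A]. Relative boundedness,
    applied to [u.1 - z.1], then gives [C u.1 --> C z.1], so that [D u.2]
    converges as well, to [w.2 - C z.1]. *)
Lemma closure_lower_triangular (R : realType) (H1 H2 : hilbertType R)
    (A : operator H1 H1) (C : operator H1 H2) (D : operator H2 H2)
    (a b : R[i]) (z w : hsum H1 H2) :
  linear_operator A -> linear_operator C -> dom A `<=` dom C ->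
  closed_operator A ->
  (forall x, dom A x -> `|C x| ^+ 2 <= a * `|x| ^+ 2 + b * `|A x| ^+ 2) ->
  closure (graph (lower_triangular A C D)) (z, w) ->
  [/\ dom A z.1, w.1 = A z.1 & closure (graph D) (z.2, w.2 - C z.1)].
Proof.
move=> Al Cl AC Acl leC /closure_graphP[F [FF [FT Fz FTz]]].
have fst_cvg (f : hsum H1 H2 -> hsum H1 H2) (l : hsum H1 H2) : f @ F --> l ->
    (fun u => (f u).1) @ F --> l.1.
  move=> /(proj2 (subr_cvg0 f l))/norm_cvg0P fl.
  apply/subr_cvg0; apply: cvg0_norm_le fl.
  by apply: nearW => u; exact: (hsum_norm_fst (f u - l)).
have snd_cvg (f : hsum H1 H2 -> hsum H1 H2) (l : hsum H1 H2) : f @ F --> l ->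
    (fun u => (f u).2) @ F --> l.2.
  move=> /(proj2 (subr_cvg0 f l))/norm_cvg0P fl.
  apply/subr_cvg0; apply: cvg0_norm_le fl.
  by apply: nearW => u; exact: (hsum_norm_snd (f u - l)).
have Fz1 := fst_cvg id _ Fz; have Fw1 := fst_cvg _ _ FTz.
have Fz2 := snd_cvg id _ Fz; have Fw2 := snd_cvg _ _ FTz.
have [Az1 w1E] : graph A (z.1, w.1).
  apply: Acl; apply/closure_graphP; exists (fst @ F); split.
    exact: fmap_proper_filter.
  by split=> //; apply: (@filterS _ F _ _ _ _ FT) => u [].
split=> //.
have FC : (fun u : hsum H1 H2 => C u.1) @ F --> C z.1.
  apply/subr_cvg0/(@cvg0_relatively_bounded _ _ F _ _ _ _ _
    (fun u : hsum H1 H2 => u.1 - z.1)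
    (fun u : hsum H1 H2 => A u.1 - A z.1) a b).
  - apply: (@filterS _ F _ _ _ _ FT) => u [Au _].
    have [Auz <-] := linear_operatorB Al Au Az1.
    have [_ <-] := linear_operatorB Cl (AC _ Au) (AC _ Az1).
    exact: leC.
  - exact/subr_cvg0.
  - by apply/subr_cvg0; rewrite -w1E.
apply/closure_graphP; exists (snd @ F); split; first exact: fmap_proper_filter.
split=> //; first by apply: (@filterS _ F _ _ _ _ FT) => u [].
have DE : (fun u : hsum H1 H2 => D u.2) =
    (fun u : hsum H1 H2 => (lower_triangular A C D u).2 - C u.1).
  by apply/funext => u /=; rewrite addrC addKr.
rewrite [X in X --> _](_ : _ = (fun u : hsum H1 H2 => D u.2) @ F)// DE.
exact: cvgB Fw2 FC.
Qed.

(** * Limiting essential spectrum from unnormalised sequences *)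

(** Unit vectors are obtained by dividing by the norms, and the inverses of the
    norms are bounded by [e^-1]; hence the weak limit and the approximate
    eigenvalue equation survive. *)
Lemma sigma_e2_bounded_below (R : realType) (H : hilbertType R)
    (B : nat -> operator H H) (l e : R[i]) (I : set nat) (x : nat -> H) :
  (forall n, linear_operator (B n)) -> infinite_set I -> 0 < e ->
  (\forall n \near within I \oo, dom (B n) (x n) /\ e <= `|x n|) ->
  weakly_cvg (within I \oo) x 0 ->
  B n (x n) - l *: x n @[n --> within I \oo] --> (0 : H) ->
  sigma_e2 B l.
Proof.
move=> Bl Iinf e0 Ix x0 Bx0.
set k := fun n => `|x n|^-1.
set J := I `&` [set n | dom (B n) (x n) /\ e <= `|x n|].
have JI : within J \oo --> within I \oo by apply: cvg_withinS => n [].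
have k_le n : e <= `|x n| -> `|k n| <= e^-1.
  move=> ex; rewrite ger0_norm ?invr_ge0// lef_pV2// posrE//.
  exact: lt_le_trans ex.
have Jk : \forall n \near within J \oo, `|k n| <= e^-1.
  by apply: filterS (@withinT nat \oo J _) => n [_ [_ /k_le]].
exists J, (fun n => k n *: x n); split.
- exact: infinite_set_near.
- move=> n [_ [Bxn exn]]; have [Bkxn _] := linear_operatorZ (k n) (Bl n) Bxn.
  split=> //; rewrite normrZ normfV normr_id mulVf//.
  by rewrite gt_eqF// (lt_le_trans e0).
- exact: weakly_cvg0_scale (weakly_cvg_subset JI x0) Jk.
- apply/norm_cvg0P; apply: (@cvg0_norm_le _ _ _ _ _ _
    (fun n => e^-1 * `|B n (x n) - l *: x n|)).
    near=> n; have [_ [Bxn exn]] : J n by near: n; exact: withinT.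
    have [_ ->] := linear_operatorZ (k n) (Bl n) Bxn.
    rewrite scalerA mulrC -scalerA -scalerBr normrZ ler_wpM2r//; exact: k_le.
  rewrite -[X in _ --> X](mulr0 e^-1); apply: cvgM; first exact: cvg_cst.
  by apply/norm_cvg0P; apply: cvg_trans Bx0; exact: cvg_app.
Unshelve. all: by end_near. Qed.

(** * Weak convergence in an orthogonal sum *)

Section WeakSum.
Variables (R : realType) (H1 H2 : hilbertType R) (F : set_system nat).

Lemma weakly_cvg_fst (z : nat -> hsum H1 H2) (l : hsum H1 H2) :
  weakly_cvg F z l -> weakly_cvg F (fun n => (z n).1) l.1.
Proof.
move=> zl y; have := zl ((y, 0) : hsum H1 H2).
rewrite hsum_innerE /= linear0r addr0.
by under eq_fun do rewrite hsum_innerE /= linear0r addr0.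
Qed.

Lemma weakly_cvg_snd (z : nat -> hsum H1 H2) (l : hsum H1 H2) :
  weakly_cvg F z l -> weakly_cvg F (fun n => (z n).2) l.2.
Proof.
move=> zl y; have := zl ((0, y) : hsum H1 H2).
rewrite hsum_innerE /= linear0r add0r.
by under eq_fun do rewrite hsum_innerE /= linear0r add0r.
Qed.

Lemma weakly_cvg_inr (y : nat -> H2) (l : H2) :
  weakly_cvg F y l -> weakly_cvg F (fun n => (0, y n) : hsum H1 H2) (0, l).
Proof.
move=> yl w; rewrite hsum_innerE /= linear0l add0r.
by under eq_fun do rewrite hsum_innerE /= linear0l add0r; exact: yl.
Qed.

End WeakSum.

Lemma hsum_norm_inr (R : realType) (H1 H2 : hilbertType R) (y : H2) :
  `|((0, y) : hsum H1 H2)| = `|y|.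
Proof. by rewrite hsum_normE normr0 expr0n add0r sqrCK. Qed.

(** * The two inclusions *)

(** A singular sequence [y_n] of [D_n] gives the singular sequence [(0, y_n)] of
    the matrices. The value of the closed matrix at [(0, y_n)] is
    [(0, D_n y_n)] for large [n] because the closure of the matrix is then
    single-valued there. *)
Lemma sigma_e2_subset_lower_triangular (R : realType) (H1 H2 : hilbertType R)
    (A : nat -> operator H1 H1) (C : nat -> operator H1 H2)
    (D : nat -> operator H2 H2) :
  (forall n, linear_operator (A n)) -> (forall n, linear_operator (C n)) ->
  (forall n, dom (A n) `<=` dom (C n)) ->
  (forall n, closed_operator (A n)) -> (forall n, closable (D n)) ->
  uniformly_bounded A C ->
  sigma_e2 D `<=`
    sigma_e2 (fun n => op_closure (lower_triangular (A n) (C n) (D n))).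
Proof.
move=> Al Cl AC Acl Dcl [a [b [N [_ _ leC]]]] l [I [y [Iinf Iy y0 Dy0]]].
set J := I `&` [set n | (N <= n)%N].
have JI : within J \oo --> within I \oo by apply: cvg_withinS => n [].
pose z n : hsum H1 H2 := (0, y n).
have z_graph n : I n -> graph (lower_triangular (A n) (C n) (D n))
    (z n, ((0, D n (y n)) : hsum H1 H2)).
  move=> In; have [A0 A0E] := linear_operator0 (Al n).
  have [_ C0E] := linear_operator0 (Cl n).
  by split=> /=; [split=> //; have [] := Iy _ In|rewrite A0E C0E add0r].
have zE n : J n ->
    op_closure (lower_triangular (A n) (C n) (D n)) (z n) = (0, D n (y n)).
  move=> [In Nn]; apply: op_closure_eq.
    by apply: subset_closure; exact: z_graph.
  move=> w /(closure_lower_triangular (Al n) (Cl n) (AC n) (Acl n)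
    (fun x => leC n x Nn))[_ /= w1 Dw2].
  have [_ A0E] := linear_operator0 (Al n).
  have [_ C0E] := linear_operator0 (Cl n).
  rewrite C0E subr0 in Dw2; rewrite A0E in w1.
  have -> : D n (y n) = w.2.
    apply: closable_uniq (Dcl n) _ Dw2; apply: subset_closure.
    by split=> //=; have [] := Iy _ In.
  by rewrite -w1; case: (w).
exists J, z; split.
- apply: infinite_set_near => //; near=> n; near: n.
  by apply: cvg_within; exact: nbhs_infty_ge.
- move=> n [In Nn]; have [Dy ny] := Iy _ In.
  split; last by rewrite hsum_norm_inr.
  by exists (0, D n (y n)); apply: subset_closure; exact: z_graph.
- exact: weakly_cvg_inr (weakly_cvg_subset JI y0).
- have Dy0J := cvg_trans (cvg_app _ JI) Dy0.
  apply: cvg_trans Dy0J; apply: near_eq_cvg; near=> n.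
  have Jn : J n by near: n; exact: withinT.
  rewrite zE// -(hsum_norm_inr H1); congr (`| _ |).
  rewrite -[RHS]/(0 - l *: 0, D n (y n) - l *: y n).
  by rewrite scaler0 subr0.
Unshelve. all: by end_near. Qed.

(** Let [z_n = (x_n, y_n)] be a singular sequence of the closed matrices. Its
    first component satisfies [(A_n - l) x_n --> 0]. If [x_n] does not tend to
    [0], a subsequence of it is bounded away from [0] and is singular for [A_n]
    after normalisation. If [x_n --> 0], then [A_n x_n --> 0], hence
    [C_n x_n --> 0]: the coupling disappears, and [y_n], whose norm tends to
    [1], is singular for the closure of [D_n]. *)
Lemma sigma_e2_lower_triangular_subset (R : realType) (H1 H2 : hilbertType R)
    (A : nat -> operator H1 H1) (C : nat -> operator H1 H2)
    (D : nat -> operator H2 H2) :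
  (forall n, linear_operator (A n)) -> (forall n, linear_operator (C n)) ->
  (forall n, linear_operator (D n)) ->
  (forall n, dom (A n) `<=` dom (C n)) ->
  (forall n, closed_operator (A n)) ->
  uniformly_bounded A C ->
  sigma_e2 (fun n => op_closure (lower_triangular (A n) (C n) (D n)))
    `<=` sigma_e2 A `|` sigma_e2 D.
Proof.
move=> Al Cl Dl AC Acl [a [b [N [_ _ leC]]]] l [I [z [Iinf Iz z0 Bz0]]].
pose B n := op_closure (lower_triangular (A n) (C n) (D n)).
pose x n := (z n).1; pose y n := (z n).2; pose w n := B n (z n).
pose d n := (w n).2 - C n (x n).
have NI : \forall n \near within I \oo, (N <= n)%N.
  by apply: cvg_within; exact: nbhs_infty_ge.
have zD n : I n -> (N <= n)%N ->
    [/\ dom (A n) (x n), (w n).1 = A n (x n)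
      & closure (graph (D n)) (y n, d n)].
  move=> In Nn; have [Bz _] := Iz _ In.
  exact: (closure_lower_triangular (Al n) (Cl n) (AC n) (Acl n)
    (fun x => leC n x Nn) (op_closure_graph Bz)).
have Ax0 : A n (x n) - l *: x n @[n --> within I \oo] --> (0 : H1).
  apply: cvg0_norm_le Bz0; near=> n.
  have [_ <- _] : [/\ dom (A n) (x n), (w n).1 = A n (x n)
      & closure (graph (D n)) (y n, d n)].
    by apply: zD; near: n => //; exact: withinT.
  exact: (hsum_norm_fst (w n - l *: z n)).
have wy0 : (w n).2 - l *: y n @[n --> within I \oo] --> (0 : H2).
  apply: cvg0_norm_le Bz0; near=> n.
  exact: (hsum_norm_snd (w n - l *: z n)).
have [x0|nx0] := pselect (x n @[n --> within I \oo] --> (0 : H1)); last first.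
  left.
  have [e [e0 nxe]] : exists e : R[i], 0 < e /\
      ~ \forall n \near within I \oo, `|x n| < e.
    apply: contrapT => ne; apply: nx0; apply/cvgr0Pnorm_lt => e e0.
    by apply: contrapT => nxe; apply: ne; exists e.
  pose J := I `&` [set n | e <= `|x n|].
  have JI : within J \oo --> within I \oo by apply: cvg_withinS => n [].
  apply: (@sigma_e2_bounded_below _ _ _ l e J x Al _ e0).
  - apply/infinite_set_natP => nJ; apply: nxe; near=> n.
    have In : I n by near: n; exact: withinT.
    rewrite real_ltNge ?ger0_real ?(ltW e0)//; apply/negP => ex.
    suff : J n by near: n; apply: cvg_within.
    by [].
  - near=> n.
    have [In ex] : J n by near: n; exact: withinT.
    split=> //; have [] // := zD n In.
    by near: n; apply: JI.
  - exact: weakly_cvg_subset JI (weakly_cvg_fst z0).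
  - exact: cvg_trans (cvg_app _ JI) Ax0.
right.
have A0 : A n (x n) @[n --> within I \oo] --> (0 : H1).
  rewrite -[X in _ --> X](addr0 0) -[X in _ + X](scaler0 _ l).
  rewrite (_ : (fun n => A n (x n))
    = fun n => (A n (x n) - l *: x n) + l *: x n).
    exact: cvgD Ax0 (cvgZl_tmp x0).
  by apply/funext => n; rewrite subrK.
have C0 : C n (x n) @[n --> within I \oo] --> (0 : H2).
  apply: (@cvg0_relatively_bounded _ _ _ _ _ _ _ _ _ _ a%:C b%:C _ x0 A0).
  near=> n; apply: leC; first by near: n.
  have [] // := zD n.
  - by near: n; exact: withinT.
  - by near: n.
have dy0 : d n - l *: y n @[n --> within I \oo] --> (0 : H2).
  rewrite -[X in _ --> X](subr0 0).
  rewrite (_ : (fun n => d n - l *: y n)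
    = fun n => ((w n).2 - l *: y n) - C n (x n)).
    exact: cvgB wy0 C0.
  by apply/funext => n; rewrite /d addrAC.
(* The points [(y n, d n)] belong to the closures of the graphs of [D n] only;
   they are replaced by points of the graphs themselves, with errors [t n]. *)
pose t n : R[i] := n.+1%:R^-1.
have t_gt0 n : 0 < t n by rewrite invr_gt0.
have t0 : t @ within I \oo --> (0 : R[i]^o).
  by apply: cvg_within_filter; exact: cvg_harmonicC.
have /choice[v vP] : forall n, exists v, I n -> (N <= n)%N ->
    [/\ dom (D n) v, `|y n - v| < t n & `|d n - D n v| < t n].
  move=> n; have [[In Nn]|nIN] := pselect (I n /\ (N <= n)%N).
    have [_ _ yd] := zD _ In Nn.
    by have [v] := closure_graph_approx yd (t_gt0 n); exists v.
  by exists 0 => In Nn; case: nIN.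
have vN : \forall n \near within I \oo,
    [/\ dom (D n) (v n), `|y n - v n| < t n & `|d n - D n (v n)| < t n].
  near=> n; apply: vP; near: n => //; exact: withinT.
have yv0 : y n - v n @[n --> within I \oo] --> (0 : H2).
  by apply: cvg0_norm_le t0; apply: filterS vN => n [_ /ltW].
have dv0 : d n - D n (v n) @[n --> within I \oo] --> (0 : H2).
  by apply: cvg0_norm_le t0; apply: filterS vN => n [_ _ /ltW].
apply: (@sigma_e2_bounded_below _ _ _ l (2^-1) I v Dl Iinf).
- by rewrite invr_gt0.
- near=> n.
  have [Dv _ _] : [/\ dom (D n) (v n), `|y n - v n| < t n
      & `|d n - D n (v n)| < t n].
    by near: n.
  split=> //.
  (* [1 <= `|x n| + `|y n - v n| + `|v n|], and each of the first two terms
     is less than [1 / 4]. *)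
  have x4 : `|x n| < 4^-1.
    by near: n; apply: cvgr0_norm_lt => //; rewrite invr_gt0.
  have yv4 : `|y n - v n| < 4^-1.
    by near: n; apply: cvgr0_norm_lt => //; rewrite invr_gt0.
  have z1 : `|z n| = 1.
    by have [] // := Iz n; near: n; exact: withinT.
  have := hsum_norm_le (z n); rewrite z1 -/(x n) -/(y n) => le1.
  rewrite -(lerD2l (4^-1 + 4^-1)).
  have -> : 4^-1 + 4^-1 + 2^-1 = 1 :> R[i] by field.
  rewrite (le_trans le1)// -addrA lerD ?(ltW x4)//.
  rewrite -[y n](subrK (v n)) (le_trans (ler_normD _ _))// lerD2r.
  exact: ltW.
- apply: weakly_cvg0_dist (weakly_cvg_snd z0) _.
  rewrite -[X in _ --> X]oppr0.
  rewrite (_ : (fun n => v n - y n) = fun n => - (y n - v n)).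
    exact: cvgN yv0.
  by apply/funext => n; rewrite opprB.
- rewrite -[X in _ --> X](subr0 0) -[X in X - _](addr0 0).
  rewrite -[X in _ + X - _](scaler0 _ l).
  rewrite (_ : (fun n => D n (v n) - l *: v n) = fun n =>
    (d n - l *: y n) + l *: (y n - v n) - (d n - D n (v n))).
    exact: cvgB (cvgD dy0 (cvgZl_tmp yv0)) dv0.
  apply/funext => n; rewrite scalerBr addrA subrK opprB [RHS]addrC.
  by rewrite addrA subrK.
Unshelve. all: by end_near. Qed.

Theorem theorem8p6 (R : realType) (H10 H20 : hilbertType R)
  (H1 : set H10) (H2 : set H20)
  (H1n : nat -> set H10) (H2n : nat -> set H20)
  (P1 : H10 -> H10) (P2 : H20 -> H20)
  (P1n : nat -> H10 -> H10) (P2n : nat -> H20 -> H20)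
  (A : nat -> operator H10 H10) (C : nat -> operator H10 H20)
  (D : nat -> operator H20 H20)
  (closedH1 : closed_subspace H1) (closedH2 : closed_subspace H2)
  (closedH1n : forall n, closed_subspace (H1n n))
  (closedH2n : forall n, closed_subspace (H2n n))
  (projP1 : orthogonal_projection H1 P1)
  (projP2 : orthogonal_projection H2 P2)
  (projP1n : forall n, orthogonal_projection (H1n n) (P1n n))
  (projP2n : forall n, orthogonal_projection (H2n n) (P2n n))
  (cvgP1n : forall x, P1n n x @[n --> \oo] --> P1 x)
  (cvgP2n : forall x, P2n n x @[n --> \oo] --> P2 x)
  (A_in : forall n, operator_from_to (H1n n) (H1n n) (A n))
  (C_in : forall n, operator_from_to (H1n n) (H2n n) (C n))
  (D_in : forall n, operator_from_to (H2n n) (H2n n) (D n))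
  (denseA : forall n, densely_defined_in (H1n n) (A n))
  (denseD : forall n, densely_defined_in (H2n n) (D n))
  (closableC : forall n, closable (C n))
  (closableD : forall n, closable (D n))
  (domAC : forall n, dom (A n) `<=` dom (C n))
  (resolventA : forall n, resolvent_set (H1n n) (A n) !=set0)
  (boundedC : uniformly_bounded A C) :
  let Abar n := op_closure (lower_triangular (A n) (C n) (D n)) in
  sigma_e2 D `<=` sigma_e2 Abar /\
  sigma_e2 Abar `<=` sigma_e2 A `|` sigma_e2 D.
Proof.
have Al n : linear_operator (A n) by have [] := A_in n.
have Cl n : linear_operator (C n) by have [] := C_in n.
have Dl n : linear_operator (D n) by have [] := D_in n.
have Acl n : closed_operator (A n).
  exact: resolvent_closed_operator (closedH1n n) (A_in n) (resolventA n).
split.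
- exact: sigma_e2_subset_lower_triangular.
- exact: sigma_e2_lower_triangular_subset.
Qed.
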